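(* Let $\mathcal F=(\mathbb X;f_1,\dots,f_N)$ and $\mathcal G=(\mathbb X;g_1,\dots,g_N)$ be contractive iterated function systems, with the same number $N$ of functions, on a complete metric space $\mathbb X$, with attractors $A_F,A_G$ and coding maps $\pi_F,\pi_G$. 1. If $h:A_F\to A_G$ is a fractal homeomorphism with corresponding sections $\tau_F$ and $\tau_G$, then $\Omega_{\tau_F}=\Omega_{\tau_G}$. Moreover $h=\pi_G\circ\tau_F$ and $h^{-1}=\pi_F\circ\tau_G$. 2. If $\tau_F$ is a shift invariant section for $\mathcal F$ and $h:=\pi_G\circ\tau_F:A_F\to A_G$ is a homeomorphism, then $h$ is a fractal homeomorphism.
   Context: An iterated function system (IFS) $\mathcal F=(\mathbb X;f_1,\dots,f_N)$ consists of continuous maps $f_i:\mathbb X\to\mathbb X$ on a complete metric space $\mathbb X$. It is contractive if each $f_i$ is a contraction (there is $0\le s<1$ with $d(f_i(x),f_i(y))\le s\,d(x,y)$ for all $x,y$). A contractive IFS has a unique attractor: the nonempty compact $A\subset\mathbb X$ with $A=\bigcup_i f_i(A)$ to which $\mathcal F^k(B)$ converges in the Hausdorff metric for every nonempty compact $B$, where $\mathcal F(B)=\bigcup_i f_i(B)$. Let $\Omega=\{1,\dots,N\}^\infty$ be the set of infinite strings; for $\sigma=i_0i_1i_2\cdots\in\Omega$ let $\sigma|_k$ be the string of its first $k$ symbols and $f_{\sigma|_k}=f_{i_0}\circ f_{i_1}\circ\cdots\circ f_{i_{k-1}}$. The coding map is $\pi:\Omega\to A$, $\pi(\sigma)=\lim_{k\to\infty}f_{\sigma|_k}(x)$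 (the limit exists and is independent of $x\in\mathbb X$). A section of $\pi$ (or of the IFS) is a function $\tau:A\to\Omega$ with $\pi\circ\tau=\mathrm{id}_A$; put $\Omega_\tau=\tau(A)$. Let $S:\Omega\to\Omega$ be the shift, $S(n\sigma)=\sigma$. A section $\tau$ is shift invariant if $\sigma\in\Omega_\tau$ implies $S(\sigma)\in\Omega_\tau$. A homeomorphism $h:A_F\to A_G$ is a fractal homeomorphism if there exist shift invariant sections $\tau_F$ of $\pi_F$ and $\tau_G$ of $\pi_G$ (the corresponding sections) such that $\tau_F=\tau_G\circ h$. *)

(* Defs.v *)
From HB Require Import structures.
From mathcomp Require Import all_boot all_order all_algebra.
From mathcomp Require Import all_classical all_reals all_analysis.

Set Implicit Arguments.
Unset Strict Implicit.
Unset Printing Implicit Defensive.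

Import Order.TTheory GRing.Theory Num.Theory.
Import numFieldNormedType.Exports.

Local Open Scope classical_set_scope.
Local Open Scope ring_scope.

(* [completeType] carries a base point, so these spaces are nonempty; this is
   no restriction where an attractor, which is nonempty, is assumed. *)
#[short(type="completeMetricType")]
HB.structure Definition CompleteMetric (K : numDomainType) :=
  { T of Metric K T & Complete T }.

Definition homeomorphism (S T : topologicalType) (h : S -> T) : Prop :=
  exists k : T -> S,
    [/\ cancel h k, cancel k h, continuous h & continuous k].

Section HausdorffDistance.
Context {R : realType} {X : metricType R}.
Implicit Types A B : set X.

Definition dist_to_set (x : X) B : \bar R :=
  ereal_inf [set (mdist x b)%:E | b in B].

Definition hausdorff_dist A B : \bar R :=
  Order.max (ereal_sup [set dist_to_set a B | a in A])
            (ereal_sup [set dist_to_set b A | b in B]).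

End HausdorffDistance.

(* The symbols 1, ..., N are represented by the elements 0, ..., N - 1 of
   ['I_N]. *)
Record ifs (X : topologicalType) (N : nat) := Ifs {
  ifs_map :> 'I_N -> X -> X;
  ifs_continuous : forall i, continuous (ifs_map i)
}.

Definition ifs_set_map (X : topologicalType) (N : nat) (F : ifs X N)
  (B : set X) : set X := \bigcup_(i in [set: 'I_N]) (F i @` B).

Definition string (N : nat) := nat -> 'I_N.

Definition left_shift (N : nat) (s : string N) : string N := fun n => s n.+1.

(* [ifs_word F [:: i0; ...; ik]] is [F i0 \o ... \o F ik]. *)
Definition ifs_word (X : topologicalType) (N : nat) (F : ifs X N)
  (w : seq 'I_N) : X -> X := foldr (fun i g => F i \o g) id w.

Section ContractiveIFS.
Context {R : realType} {X : completeMetricType R} {N : nat}.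
Implicit Types (F : ifs X N) (A B : set X) (s : string N).

Definition contraction_map (f : X -> X) : Prop :=
  exists2 c : R, 0 <= c < 1 & forall x y, mdist (f x) (f y) <= c * mdist x y.

Definition contractive F : Prop := forall i, contraction_map (F i).

Definition is_attractor F A : Prop :=
  [/\ A !=set0, compact A, A = ifs_set_map F A &
      forall B, B !=set0 -> compact B ->
        hausdorff_dist (iter k (ifs_set_map F) B) A @[k --> \oo] --> (0 : \bar R)%E].

(* The limit does not depend on the base point, see [coding_lim_cvg]. *)
Definition coding_lim F s : X :=
  lim (ifs_word F (mkseq s k) point @[k --> \oo]).

Lemma contractive_uniform F : contractive F ->
  exists2 c : R, 0 <= c < 1 &
    forall i x y, mdist (F i x) (F i y) <= c * mdist x y.
Proof.
move=> cF; have /boolp.choice[c cP] i : exists c : R, 0 <= c < 1 /\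
    forall x y, mdist (F i x) (F i y) <= c * mdist x y.
  by have [c c01 cl] := cF i; exists c.
exists (\big[Num.max/0]_i c i).
  apply/andP; split; first exact: bigmax_ge_id.
  by apply: bigmax_lt => // i _; have [/andP[]] := cP i.
move=> i x y; have [_ ci] := cP i.
apply: (le_trans (ci x y)); apply: ler_wpM2r; first exact: mdist_ge0.
exact: le_bigmax.
Qed.

Lemma ifs_word_dist F (c : R) : 0 <= c ->
  (forall i x y, mdist (F i x) (F i y) <= c * mdist x y) ->
  forall w x y,
    mdist (ifs_word F w x) (ifs_word F w y) <= c ^+ size w * mdist x y.
Proof.
move=> c0 cF w x y; elim: w => [|i w IHw] /=; first by rewrite expr0 mul1r.
by rewrite (le_trans (cF _ _ _))// exprS -mulrA ler_wpM2l.
Qed.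

Lemma ifs_word_cat F (u v : seq 'I_N) x :
  ifs_word F (u ++ v) x = ifs_word F u (ifs_word F v x).
Proof. by elim: u => //= i u ->. Qed.

Lemma ifs_word_bounded F (c : R) : 0 <= c < 1 ->
  (forall i x y, mdist (F i x) (F i y) <= c * mdist x y) ->
  forall x, exists2 M : R, 0 <= M & forall w, mdist x (ifs_word F w x) <= M.
Proof.
move=> /andP[c0 c1] cF x.
pose D := \big[Num.max/0]_i mdist x (F i x).
have D0 : 0 <= D by exact: bigmax_ge_id.
have c10 : 0 < 1 - c by rewrite subr_gt0.
exists (D / (1 - c)); first by rewrite divr_ge0// ltW.
elim=> [|i w IHw] /=; first by rewrite mdistxx divr_ge0// ltW.
apply: (le_trans (metric_triangle _ (F i x) _)).
have -> : D / (1 - c) = D + c * (D / (1 - c)).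
  have c1' : 1 - c != 0 by rewrite gt_eqF.
  by apply: (mulIf c1'); rewrite mulrDl mulrA !divfK// mulrBr mulr1 mulrC subrK.
apply: lerD; first exact: le_bigmax.
by apply: (le_trans (cF _ _ _)); rewrite ler_wpM2l.
Qed.

Lemma coding_lim_cvg F : contractive F -> forall s x,
  ifs_word F (mkseq s k) x @[k --> \oo] --> coding_lim F s.
Proof.
move=> /contractive_uniform[c c01 cF] s x; have /andP[c0 c1] := c01.
have geo0 (M : R) : M * c ^+ k @[k --> \oo] --> (0 : R).
  by apply: cvg_geometric; rewrite ger0_norm.
have cvg0 : ifs_word F (mkseq s k) point @[k --> \oo] --> coding_lim F s.
  have [M M0 MP] := ifs_word_bounded c01 cF point.
  apply: cauchy_cvg; apply: cauchy_exP => e e0.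
  have /cvgrPdist_lt/(_ e e0)[k _ kP] := geo0 M.
  exists (ifs_word F (mkseq s k) point); exists k => //= n /= kn.
  rewrite ballEmdist /= -(subnKC kn) /mkseq iotaD add0n map_cat ifs_word_cat.
  apply: (le_lt_trans (ifs_word_dist c0 cF _ _ _)).
  rewrite size_map size_iota.
  apply: (@le_lt_trans _ _ (M * c ^+ k)).
    by rewrite mulrC ler_wpM2r// exprn_ge0.
  have := kP k (leqnn k); rewrite sub0r normrN ger0_norm//.
  by rewrite mulr_ge0// exprn_ge0.
apply/metricType_numDomainType.cvgrPdist_lt => e e0.
have e20 : 0 < e / 2 by rewrite divr_gt0.
have /metricType_numDomainType.cvgrPdist_lt/(_ _ e20) lim0 := cvg0.
have /cvgrPdist_lt/(_ _ e20) near0 := geo0 (mdist (point : X) x).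
near=> k.
apply: (le_lt_trans (metric_triangle _ (ifs_word F (mkseq s k) point) _)).
rewrite [ltRHS]splitr; apply: ltrD; first by near: k.
apply: (le_lt_trans (ifs_word_dist c0 cF _ _ _)).
rewrite size_mkseq mulrC.
apply: (@le_lt_trans _ _ `|0 - mdist (point : X) x * c ^+ k|); last by near: k.
by rewrite sub0r normrN ler_norm.
Unshelve. all: by end_near. Qed.

Lemma ifs_word_attractor F A : is_attractor F A ->
  forall w x, A x -> A (ifs_word F w x).
Proof.
move=> [_ _ AE _] w x Ax; elim: w => //= i w IHw.
by rewrite AE; exists i => //; exists (ifs_word F w x).
Qed.

Lemma coding_lim_attractor F A : contractive F -> is_attractor F A ->
  forall s, coding_lim F s \in A.
Proof.
move=> cF aF s; apply/mem_set.
have [[a Aa] cA _ _] := aF.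
have clA : closed A by apply: compact_closed => //; exact: metric_hausdorff.
apply: closed_cvg (coding_lim_cvg cF a) => //.
by apply: nearW => k; exact: (ifs_word_attractor aF).
Qed.

Definition coding_map F A (cF : contractive F) (aF : is_attractor F A)
  (s : string N) : A := exist _ (coding_lim F s) (coding_lim_attractor cF aF s).

End ContractiveIFS.

Section Sections.
Context {R : realType} {X : completeMetricType R} {N : nat}.

Definition is_section (A : set X) (p : string N -> A) (t : A -> string N)
  : Prop := p \o t = id.

Definition shift_invariant (A : set X) (t : A -> string N) : Prop :=
  forall s, range t s -> range t (left_shift s).

Definition corresponding_sections (A B : set X) (pA : string N -> A)
    (pB : string N -> B) (h : A -> B) (tA : A -> string N)
    (tB : B -> string N) : Prop :=
  [/\ is_section pA tA /\ shift_invariant tA,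
      is_section pB tB /\ shift_invariant tB &
      tA = tB \o h].

Definition fractal_homeomorphism (A B : set X) (pA : string N -> A)
    (pB : string N -> B) (h : A -> B) : Prop :=
  homeomorphism h /\
  exists tA tB, corresponding_sections pA pB h tA tB.

End Sections.

(* Main.v *)
Require Import Defs.
From mathcomp Require Import all_boot all_order all_algebra.
From mathcomp Require Import all_classical all_reals all_analysis.

(** A section is a right inverse of its coding map; both parts follow by composing
    the relation between the two sections with this equation.

    If [tauF = tauG \o h] with [h] bijective, precomposing [tauG] with [h] does
    not change its range, hence the two sections have the same image.  Applying
    [piG] to the equation and using [piG \o tauG = id] gives [piG \o tauF = h];
    applying [piF] and using [piF \o tauF = id] shows that [piF \o tauG] is a
    left inverse of [h], and a left inverse of a bijection is its inverse
    ([corresponding_sections_inverse]).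

    Conversely, if [h = piG \o tauF] has an inverse [k], the equation
    [tauF = tauG \o h] leaves no choice but [tauG = tauF \o k].  It is a section
    of [piG] because [piG \o tauF \o k = h \o k = id], and it is shift invariant
    because shift invariance is a property of the image alone, which [tauG]
    shares with [tauF] ([corresponding_sections_transport]). *)

Local Open Scope classical_set_scope.
Local Open Scope ring_scope.

Lemma range_comp_cancel (S T U : Type) (t : T -> U) (h : S -> T) (k : T -> S) :
  cancel k h -> range (t \o h) = range t.
Proof.
move=> kh; apply/seteqP; split=> _ [x _ <-]; first by exists (h x).
by exists (k x) => //=; rewrite kh.
Qed.

Arguments range_comp_cancel {S T U} t {h k}.

Section CorrespondingSections.
Context {R : realType} {X : completeMetricType R} {N : nat} {A B : set X}.
Context {pA : string N -> A} {pB : string N -> B}.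
Implicit Types (h : A -> B) (k : B -> A).
Implicit Types (tA : A -> string N) (tB : B -> string N).

Lemma corresponding_sections_range h k tA tB : cancel k h ->
  corresponding_sections pA pB h tA tB -> range tA = range tB.
Proof. by move=> kh [_ _ ->]; exact: range_comp_cancel. Qed.

Lemma corresponding_sections_map h tA tB :
  corresponding_sections pA pB h tA tB -> h = pB \o tA.
Proof. by move=> [_ [secB _] ->]; rewrite compA secB. Qed.

(** The point [pA (tB (h x))] is [pA (tA x) = x], so [pA \o tB] agrees with the
    given inverse [k] and therefore inverts [h] on both sides. *)
Lemma corresponding_sections_inverse h k tA tB : cancel h k -> cancel k h ->
  corresponding_sections pA pB h tA tB ->
  cancel h (pA \o tB) /\ cancel (pA \o tB) h.
Proof.
move=> hk kh [[secA _] _ tE].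
have hI : cancel h (pA \o tB).
  by move=> x; move: secA; rewrite /is_section tE => /(congr1 (@^~ x)).
by split=> // y; rewrite -[y]kh hI.
Qed.

(** The section [tA] is carried to the other side along the inverse [k] of
    [pB \o tA]; its image, and with it shift invariance, is unchanged. *)
Lemma corresponding_sections_transport tA k :
  is_section pA tA -> shift_invariant tA ->
  cancel (pB \o tA) k -> cancel k (pB \o tA) ->
  corresponding_sections pA pB (pB \o tA) tA (tA \o k).
Proof.
move=> secA shA hk kh; split=> //; last first.
  by apply/funext => x /=; rewrite -[k _]/(k ((pB \o tA) x)) hk.
split; first by apply/funext => y; exact: kh.
by rewrite /shift_invariant (range_comp_cancel tA hk).
Qed.

End CorrespondingSections.

Theorem theorem5 (R : realType) (X : completeMetricType R) (N : nat)
    (F G : ifs X N) (cF : contractive F) (cG : contractive G)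
    (AF AG : set X) (aF : is_attractor F AF) (aG : is_attractor G AG) :
  let piF : string N -> AF := coding_map cF aF in
  let piG : string N -> AG := coding_map cG aG in
  (forall h : AF -> AG, fractal_homeomorphism piF piG h ->
    forall (tauF : AF -> string N) (tauG : AG -> string N),
      corresponding_sections piF piG h tauF tauG ->
      [/\ range tauF = range tauG,
          h = piG \o tauF &
          cancel h (piF \o tauG) /\ cancel (piF \o tauG) h]) /\
  (forall tauF : AF -> string N,
    is_section piF tauF -> shift_invariant tauF ->
    homeomorphism (piG \o tauF) ->
    fractal_homeomorphism piF piG (piG \o tauF)).
Proof.
move=> piF piG; split=> [h [[k [hk kh _ _]] _] tauF tauG corr|tauF secF shF homeo].
  split; first exact: corresponding_sections_range kh corr.
  - exact: corresponding_sections_map corr.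
  - exact: corresponding_sections_inverse hk kh corr.
split=> //; have [k [hk kh _ _]] := homeo.
by exists tauF, (tauF \o k); exact: corresponding_sections_transport.
Qed.
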